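(* There exists a chordal (hence perfect) graph $G$ such that $\chi(G)=\delta(G)+1$ and ${\cal F}(G)=\emptyset$. In particular, it is not true that every perfect graph $G$ satisfies the equivalence $\chi(G)=\delta(G)+1 \Leftrightarrow {\cal F}(G)=\{\chi(G)\}$.
   Context: Graphs are finite and simple. $\chi(G)$ is the chromatic number and $\delta(G)$ the minimum degree. For a proper coloring $f:V(G)\to\{1,\dots,k\}$, a vertex $v$ is a b-vertex if it has at least one neighbor in every color class $j\in\{1,\dots,k\}$, $j\neq f(v)$. A fall-coloring is a proper coloring in which every vertex is a b-vertex. ${\cal F}(G)$ is the set of all $k$ for which $G$ has a fall-coloring with $k$ colors. *)

(* Defs.v *)
From mathcomp Require Import all_boot.

Set Implicit Arguments.
Unset Strict Implicit.
Unset Printing Implicit Defensive.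

Record sgraph := SGraph {
  vertex :> finType;
  adj : rel vertex;
  adj_sym : symmetric adj;
  adj_irrefl : irreflexive adj }.

Section Graph.

Variable G : sgraph.

Definition degree (v : G) : nat := #|[set u | adj v u]|.

(* Every degree is below #|G|, so the default value is irrelevant as soon as G
   has a vertex. *)
Definition min_degree : nat := \big[minn/#|G|]_(v : G) degree v.

(* The colors 1, ..., k are represented by 'I_k. *)
Definition proper_coloring (k : nat) (f : {ffun G -> 'I_k}) : bool :=
  [forall u, forall v, adj u v ==> (f u != f v)].

Definition colorable (k : nat) : bool :=
  [exists f : {ffun G -> 'I_k}, proper_coloring f].

Lemma colorable_card : exists k, colorable k.
Proof.
exists #|G|; apply/existsP; exists [ffun v => enum_rank v].
apply/forallP => u; apply/forallP => v; apply/implyP => uv.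
rewrite !ffunE (inj_eq enum_rank_inj).
by apply: contraTneq uv => ->; rewrite adj_irrefl.
Qed.

Definition chi : nat := ex_minn colorable_card.

Definition b_vertex (k : nat) (f : {ffun G -> 'I_k}) (v : G) : bool :=
  [forall j, (j != f v) ==> [exists u, adj v u && (f u == j)]].

Definition fall_coloring (k : nat) (f : {ffun G -> 'I_k}) : bool :=
  proper_coloring f && [forall v, b_vertex f v].

(* Surjectivity of f need not be required: if G has a vertex, a coloring in
   which some vertex is a b-vertex uses all k colors. *)
Definition fall_set : pred nat :=
  [pred k | [exists f : {ffun G -> 'I_k}, fall_coloring f]].

Definition is_clique (A : {set G}) : bool :=
  [forall u in A, forall v in A, (u != v) ==> adj u v].

Definition omega : nat := \max_(A : {set G} | is_clique A) #|A|.

Definition chord (c : seq G) (x y : G) : bool :=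
  [&& x \in c, y \in c, adj x y, y != next c x & x != next c y].

Definition chordal : Prop :=
  forall c : seq G, ucycle (@adj G) c -> 4 <= size c ->
  exists x y, chord c x y.

End Graph.

Section Induced.

Variables (G : sgraph) (S : {set G}).

Definition induced_adj : rel {x : G | x \in S} :=
  fun x y => adj (val x) (val y).

Lemma induced_adj_sym : symmetric induced_adj.
Proof. by move=> x y; exact: adj_sym. Qed.

Lemma induced_adj_irrefl : irreflexive induced_adj.
Proof. by move=> x; exact: adj_irrefl. Qed.

Definition induced : sgraph := SGraph induced_adj_sym induced_adj_irrefl.

End Induced.

Definition perfect (G : sgraph) : Prop :=
  forall S : {set G}, chi (induced S) = omega (induced S).

(* Main.v *)
Require Import Defs.
From mathcomp Require Import all_boot.

Set Implicit Arguments.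
Unset Strict Implicit.
Unset Printing Implicit Defensive.

(** The counterexample is a 3-sun with cliques hung on its tips. Start from a
    core triangle t_0, t_1, t_2 and three tips x_0, x_1, x_2, where x_j is
    adjacent to t_i exactly when i != j, and enlarge each tip to a clique K_5
    by four private vertices. The largest cliques are these three copies of
    K_5, so the chromatic number is 5, and the minimum degree is 4.

    A b-vertex in a k-coloring has degree at least k - 1, and when its degree
    is exactly k - 1 its closed neighborhood is rainbow, that is, its colors
    are pairwise distinct ([b_vertex_rainbow]). Hence a fall-coloring could
    only use k = 5 colors, and since each core vertex has degree 4, each closed
    neighborhood N[t_i] would be rainbow. But any two of the six vertices of
    the sun lie together in some N[t_i] ([sun_point_near_core]), so these six
    vertices would need six different colors ([sun_fall_set]).

    Chordality and perfection both come from a perfect elimination ordering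
    ([elimination_chordal], [elimination_perfect]): core first, then the tips,
    then the private vertices. *)

(** * Cliques, colorings and degrees *)

Section Basics.

Variable G : sgraph.

Lemma is_cliqueP (A : {set G}) :
  reflect {in A &, forall u v, u != v -> adj u v} (is_clique A).
Proof.
apply: (iffP forall_inP) => cA u.
  by move=> v uA vA; move/forall_inP: (cA u uA) => /(_ v vA) /implyP.
by move=> uA; apply/forall_inP => v vA; apply/implyP; apply: cA.
Qed.

Lemma clique_le_omega (A : {set G}) : is_clique A -> #|A| <= omega G.
Proof. by move=> cA; apply: (bigmax_sup A). Qed.

Lemma proper_coloringP k (f : {ffun G -> 'I_k}) :
  reflect (forall u v, adj u v -> f u != f v) (proper_coloring f).
Proof.
apply: (iffP forallP) => pf u; first by move=> v; move/forallP/(_ v)/implyP: (pf u).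
by apply/forallP => v; apply/implyP; apply: pf.
Qed.

Lemma colorable_omega k : colorable G k -> omega G <= k.
Proof.
case/existsP => f /proper_coloringP pf; apply/bigmax_leqP => A /is_cliqueP cA.
rewrite -[k]card_ord -(card_in_imset (f := f)) ?max_card //.
move=> u v uA vA /eqP; apply: contraTeq => /(cA _ _ uA vA); exact: pf.
Qed.

Lemma chi_min k : colorable G k -> chi G <= k.
Proof. by rewrite /chi; case: ex_minnP => m _; apply. Qed.

Lemma colorable_chi : colorable G (chi G).
Proof. by rewrite /chi; case: ex_minnP. Qed.

Lemma min_degree_le (v : G) : min_degree G <= degree v.
Proof.
rewrite /min_degree; elim: index_enum (mem_index_enum v) => //= u s IHs.
rewrite inE big_cons geq_min => /predU1P[->|/IHs ->]; first by rewrite leqnn.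
exact: orbT.
Qed.

End Basics.

(** * Perfect elimination orderings *)

Section Elimination.

Variable G : sgraph.

(** A perfect elimination ordering, given by ranks: the lower-ranked neighbors
    of every vertex form a clique. Non-adjacent vertices may share a rank, so
    ranks need not number the vertices one by one. *)
Definition elimination_rank (r : G -> nat) : Prop :=
  (forall u v, adj u v -> r u != r v) /\
  (forall v, is_clique [set u | adj v u & r u < r v]).

(** On a cycle, the two neighbors of a vertex of largest rank both have lower
    rank, so they are adjacent; this edge is a chord since the cycle has at
    least four vertices. *)
Lemma elimination_chordal r : elimination_rank r -> chordal G.
Proof.
move=> [rneq rcl] c /andP[cyc unc] c4.
have [v0 v0c] : exists v, v \in c.
  by case: c c4 {cyc unc} => // v c _; exists v; rewrite mem_head.
pose v := [arg max_(u > v0 in c) r u].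
have [vc vmax] : v \in c /\ forall u, u \in c -> r u <= r v.
  by rewrite /v; case: arg_maxnP.
(* Rotate the cycle to start at v: it becomes v, x, z, ..., y. *)
have [i s def_s] := rot_to vc.
have uns : uniq (v :: s) by rewrite -def_s rot_uniq.
have cys : cycle (@adj G) (v :: s) by rewrite -def_s rot_cycle.
have mems u : (u \in c) = (u \in v :: s) by rewrite -def_s mem_rot.
have nexts u : next c u = next (v :: s) u by rewrite -def_s next_rot.
have sz : 4 <= size (v :: s) by rewrite -def_s size_rot.
case: s {def_s} uns cys mems nexts sz => [|x [|z s]] //.
elim/last_ind: s => [|s y _] // uns cys mems nexts _.
have low u : u \in c -> adj v u -> u \in [set u | adj v u & r u < r v].
  move=> uc vu; rewrite inE vu ltn_neqAle (vmax _ uc) andbT.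
  by rewrite eq_sym; exact: rneq.
have xc : x \in c by rewrite mems !inE eqxx orbT.
have yc : y \in c by rewrite mems !inE mem_rcons mem_head !orbT.
have vx : adj v x by case/andP: cys.
have vy : adj v y.
  by move: cys; rewrite adj_sym /= !rcons_path last_rcons => /and4P[].
move: uns; rewrite /= !inE !mem_rcons !rcons_uniq !inE !negb_or.
case/and4P => /and4P[nvx nvz nvy nvs] /and3P[nxz nxy nxs] /andP[nzy nzs].
case/andP=> nys uns.
exists x, y; apply/and5P; split=> //.
- by move/is_cliqueP: (rcl v); apply => //; apply: low.
- by rewrite nexts /= [x == v]eq_sym (negPf nvx) eqxx eq_sym.
rewrite nexts.
(* Rotating y to the front makes v its visible successor. *)
rewrite -[[:: v, x, z & rcons s y]]/(rcons [:: v, x, z & s] y).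
rewrite -(next_rotr 1); last by rewrite /= !inE !mem_rcons !rcons_uniq !inE
  !negb_or nvx nvz nvy nvs nxz nxy nxs nzy nzs nys.
by rewrite rotr1_rcons /= eqxx eq_sym.
Qed.

(** Greedy coloring along the ranks: v and its lower neighbors form a clique, so
    these neighbors number less than omega and leave a color free for v. *)
Lemma elimination_colorable r : elimination_rank r -> colorable G (omega G).
Proof.
move=> [rneq rcl].
have lowP v : #|[set u | adj v u & r u < r v]| < omega G.
  set L := [set _ | _ & _].
  have vL : v \notin L by rewrite inE adj_irrefl.
  rewrite -[#|L|.+1]/(1 + #|L|) -[1]/(nat_of_bool true) -vL -cardsU1.
  apply: clique_le_omega.
  apply/is_cliqueP => a b; rewrite !inE.
  case/predU1P=> [->|/andP[va ra]] /predU1P[->|/andP[vb rb]] ab //.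
  - by rewrite eqxx in ab.
  - by rewrite adj_sym.
  - by move/is_cliqueP: (rcl v); apply; rewrite ?inE ?va ?vb.
(* Vertices of equal rank are non-adjacent, so a whole level is colored at once. *)
have step n : exists f : G -> 'I_(omega G), forall u v,
    r u < n -> r v < n -> adj u v -> f u != f v.
  elim: n => [|n [f pf]].
    have /fin_all_exists[f _] : forall v : G, exists i : 'I_(omega G), True.
      by move=> v; exists (Ordinal (leq_ltn_trans (leq0n _) (lowP v))).
    by exists f.
  have /fin_all_exists[g gP] : forall v : G, exists i : 'I_(omega G),
      (r v < n -> i = f v) /\
      (r v = n -> forall u, adj v u -> r u < n -> f u != i).
    move=> v; have [rv|rv|rv] := ltngtP (r v) n.
    - by exists (f v); split=> // rvn; rewrite rvn ltnn in rv.
    - by exists (f v); split=> // rvn; rewrite rvn ltnn in rv.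
    have : #|f @: [set u | adj v u & r u < r v]| < #|'I_(omega G)|.
      by rewrite card_ord (leq_ltn_trans (leq_imset_card _ _)).
    rewrite -cardsT ltnNge => /(contraNN (@subset_leq_card _ _ _)).
    case/subsetPn => i _ iL; exists i; split=> // _ u vu run.
    by apply: contraNneq iL => <-; apply: imset_f; rewrite inE vu rv.
  exists g => u v; rewrite !ltnS => run rvn uv.
  have [gu gun] := gP u; have [gv gvn] := gP v.
  case: (ltngtP (r u) n) run => // ru _; case: (ltngtP (r v) n) rvn => // rv _.
  - by rewrite gu // gv //; apply: pf.
  - by rewrite gu //; apply: gvn => //; rewrite adj_sym.
  - by rewrite gv // eq_sym; apply: gun.
  - by move: (rneq _ _ uv); rewrite ru rv eqxx.
have [f pf] := step (\max_v r v).+1.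
apply/existsP; exists [ffun v => f v]; apply/proper_coloringP => u v uv.
by rewrite !ffunE; apply: pf => //; rewrite ltnS; apply: leq_bigmax.
Qed.

Lemma elimination_chi r : elimination_rank r -> chi G = omega G.
Proof.
move=> /elimination_colorable cG; apply/eqP.
by rewrite eqn_leq chi_min //= colorable_omega // colorable_chi.
Qed.

End Elimination.

Lemma induced_elimination (G : sgraph) (S : {set G}) (r : G -> nat) :
  elimination_rank r ->
  @elimination_rank (induced S) (fun x => r (val x)).
Proof.
move=> [rneq rcl]; split=> [u v|v]; first exact: rneq.
apply/is_cliqueP => a b; rewrite !inE => /andP[va ra] /andP[vb rb] ab.
by move/is_cliqueP: (rcl (val v)); apply; rewrite ?inE ?ra ?rb ?andbT.
Qed.

Lemma elimination_perfect (G : sgraph) (r : G -> nat) :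
  elimination_rank r -> perfect G.
Proof. by move=> rG S; apply: elimination_chi (induced_elimination S rG). Qed.

(** * b-vertices of small degree *)

Section BVertex.

Variable G : sgraph.

Lemma b_vertex_imset k (f : {ffun G -> 'I_k}) v :
  b_vertex f v -> f @: (v |: [set u | adj v u]) = [set: 'I_k].
Proof.
move/forallP => bv; apply/setP => j; rewrite inE; apply/imsetP.
have [->|nj] := eqVneq j (f v); first by exists v; rewrite ?setU11.
have /existsP[u /andP[vu /eqP fu]] := implyP (bv j) nj.
by exists u; rewrite // !inE vu orbT.
Qed.

Lemma card_closed_nbhd (v : G) : #|v |: [set u | adj v u]| = (degree v).+1.
Proof. by rewrite cardsU1 inE adj_irrefl. Qed.

Lemma b_vertex_degree k (f : {ffun G -> 'I_k}) v :
  b_vertex f v -> k <= (degree v).+1.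
Proof.
move/b_vertex_imset => im; rewrite -card_closed_nbhd -[k]card_ord -cardsT -im.
exact: leq_imset_card.
Qed.

(** The closed neighborhood of v meets all k colors but has at most k
    vertices, so no color is repeated in it. *)
Lemma b_vertex_rainbow k (f : {ffun G -> 'I_k}) v :
  b_vertex f v -> degree v < k ->
  {in v |: [set u | adj v u] &, injective f}.
Proof.
move=> bv dk; apply/imset_injP; rewrite b_vertex_imset // cardsT card_ord.
by rewrite card_closed_nbhd eqn_leq dk (b_vertex_degree bv).
Qed.

End BVertex.

(** * The sun with cliques on its tips *)

(** [inl i] is the core vertex t_i; [inr (j, a)] ranges over the K_5 hung on
    the j-th tip, and [inr (j, ord0)] is the tip itself. *)
Definition sun_vertex : finType := ('I_3 + 'I_3 * 'I_5)%type.

Definition sun_adj : rel sun_vertex := fun u v =>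
  match u, v with
  | inl i, inl j => i != j
  | inl i, inr (j, a) | inr (j, a), inl i => (i != j) && (a == ord0)
  | inr (i, a), inr (j, b) => (i == j) && (a != b)
  end.

Lemma sun_adj_sym : symmetric sun_adj.
Proof.
move=> [i|[i a]] [j|[j b]] //=; first by rewrite eq_sym.
by rewrite (eq_sym i) (eq_sym a).
Qed.

Lemma sun_adj_irrefl : irreflexive sun_adj.
Proof. by move=> [i|[i a]] /=; rewrite !eqxx. Qed.

Definition sun : sgraph := SGraph sun_adj_sym sun_adj_irrefl.

Definition core (i : 'I_3) : sun := inl i.

Definition sun_rank (v : sun) : nat :=
  match v with inl i => i | inr (_, a) => 3 + a end.

(** The lower neighbors of a tip are two core vertices, and those of a private
    vertex lie in its own K_5. *)
Lemma sun_elimination : elimination_rank sun_rank.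
Proof.
have core_lt (i : 'I_3) (a : 'I_5) : i < 3 + a by rewrite ltn_addr.
have tip_core (i : 'I_3) (a : 'I_5) : (3 + a < i) = false.
  by rewrite ltnNge ltnW // core_lt.
split=> [[i|[i a]] [j|[j b]] //|v].
- by move=> _; rewrite neq_ltn core_lt.
- by move=> _; rewrite neq_ltn core_lt orbT.
- by rewrite /= eqn_add2l => /andP[].
apply/is_cliqueP => u w; rewrite !inE.
case: v u w => [i|[i a]] [j|[j b]] [l|[l c]]; rewrite /adj /sun_rank ?tip_core ?andbF //.
- by case/andP=> /andP[_ /eqP->] _ /andP[_]; rewrite ltn_add2l.
- by case/andP=> _ + /andP[/andP[_ /eqP a0] _]; rewrite a0 ltn_add2l.
case/andP=> /andP[/eqP<- _] _ /andP[/andP[/eqP<- _] _] /=.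
by rewrite eqxx; apply: contraNneq => ->.
Qed.

Lemma sun_degree (v : sun) :
  degree v = if v is inr (_, a) then if a == ord0 then 6 else 4 else 4.
Proof.
have -> : degree v = \sum_(i : 'I_3) adj v (inl i) +
    \sum_(i : 'I_3) \sum_(a : 'I_5) adj v (inr (i, a)).
  rewrite /degree -sum1_card big_mkcond big_sumType pair_bigA /=.
  congr (_ + _); first by apply: eq_bigr => i _; rewrite inE; case: (adj v _).
  by apply: eq_bigr => -[i a] _; rewrite inE; case: (adj v _).
rewrite !big_ord_recl !big_ord0.
by case: v => [[[|[|[|//]]] ?]|[[[|[|[|//]]] ?] [[|[|[|[|[|//]]]]] ?]]].
Qed.

Lemma sun_min_degree : min_degree sun = 4.
Proof.
apply/eqP; rewrite eqn_leq; apply/andP; split.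
  by have := min_degree_le (core ord0); rewrite sun_degree.
rewrite /min_degree; elim/big_ind: _ => [|m n m4 n4|v _].
- by rewrite card_sum card_prod !card_ord.
- by rewrite leq_min m4.
by rewrite sun_degree; case: v => // -[_ a]; case: ifP.
Qed.

(** The ranks modulo 5 are a proper coloring: core vertices get 0, 1, 2, every
    tip gets 3, and the K_5 at a tip sees five consecutive ranks. *)
Lemma sun_colorable : colorable sun 5.
Proof.
pose color (v : sun) : 'I_5 := Ordinal (ltn_pmod (sun_rank v) (isT : 0 < 5)).
have small (i : 'I_3) : i %% 5 = i by rewrite modn_small // (ltn_trans (ltn_ord i)).
have tip (i : 'I_3) : (i == 3 :> nat) = false by rewrite ltn_eqF.
apply/existsP; exists [ffun v => color v]; apply/proper_coloringP.
move=> [i|[i a]] [j|[j b]] uv; rewrite !ffunE -val_eqE /= ?small.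
- by [].
- by case/andP: uv => _ /eqP->; rewrite tip.
- by case/andP: uv => _ /eqP->; rewrite eq_sym tip.
by case/andP: uv => _; rewrite eqn_modDl !modn_small.
Qed.

Lemma sun_omega : 5 <= omega sun.
Proof.
have <- : #|[set (inr (ord0, a) : sun) | a : 'I_5]| = 5.
  by rewrite card_imset ?card_ord // => a b [].
apply: clique_le_omega; apply/is_cliqueP => _ _ /imsetP[a _ ->] /imsetP[b _ ->] ab.
by apply/andP; split=> //; apply: contraNneq ab => ->.
Qed.

Lemma sun_chi : chi sun = 5.
Proof.
apply/eqP; rewrite eqn_leq chi_min ?sun_colorable //=.
by rewrite (leq_trans sun_omega) // colorable_omega // colorable_chi.
Qed.

(** The six vertices of the 3-sun, without the private vertices. *)
Definition sun_point (p : 'I_3 + 'I_3) : sun :=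
  match p with inl i => core i | inr j => inr (j, ord0) end.

(** N[t_i] misses only the tip x_i, and two vertices of the sun cannot
    involve all three tips, so some i is free for both. *)
Lemma sun_point_near_core (p q : 'I_3 + 'I_3) : exists i,
  (sun_point p \in core i |: [set u | adj (core i) u]) &&
  (sun_point q \in core i |: [set u | adj (core i) u]).
Proof.
have near i p' : (sun_point p' \in core i |: [set u | adj (core i) u]) =
    if p' is inr j then i != j else true.
  case: p' => j; rewrite !inE /= ?andbT //.
  by rewrite -[_ == _]/(j == i) eq_sym orbN.
have avoid (j l : 'I_3) : exists i, (i != j) && (i != l).
  have : #|[set j; l]| < #|'I_3| by rewrite card_ord cards2; case: eqP.
  rewrite -cardsT ltnNge => /(contraNN (@subset_leq_card _ _ _)).
  by case/subsetPn => i _; rewrite !inE negb_or; exists i.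
case: p q => [i|j] [i'|j'].
- by exists ord0; rewrite !near.
- by have [i0 /andP[i0j _]] := avoid j' j'; exists i0; rewrite !near.
- by have [i0 /andP[i0j _]] := avoid j j; exists i0; rewrite !near i0j.
- by have [i0 i0P] := avoid j j'; exists i0; rewrite !near.
Qed.

(** Rainbow neighborhoods of the core make a fall-coloring injective on the six
    vertices of the sun, although the degree of a core vertex allows only five
    colors. *)
Lemma sun_fall_set : fall_set sun =i pred0.
Proof.
move=> k; apply/negbTE/negP; rewrite /fall_set inE => /existsP[f /andP[pf /forallP bf]].
have k5 : k <= 5 by have := b_vertex_degree (bf (core ord0)); rewrite sun_degree.
have k5' : 5 <= k.
  by rewrite (leq_trans sun_omega) // colorable_omega //; apply/existsP; exists f.
have injf : injective (f \o sun_point).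
  move=> p q /= fpq; have [i /andP[pi qi]] := sun_point_near_core p q.
  have dk : degree (core i) < k by rewrite sun_degree.
  have := b_vertex_rainbow (bf (core i)) dk pi qi fpq.
  by case: p q {fpq pi qi} => [i1|j1] [i2|j2] // [->].
by have := leq_card _ injf; rewrite card_sum !card_ord leqNgt ltnS k5.
Qed.

Theorem mainTheorem3 :
  (exists G : sgraph,
     0 < #|G| /\ chordal G /\ perfect G /\
     chi G = (min_degree G).+1 /\ fall_set G =i pred0) /\
  ~ (forall G : sgraph, 0 < #|G| -> perfect G ->
       (chi G = (min_degree G).+1 <-> fall_set G =i pred1 (chi G))).
Proof.
have sun0 : 0 < #|sun| by apply/card_gt0P; exists (core ord0).
have sunP := elimination_perfect sun_elimination.
have sunchi : chi sun = (min_degree sun).+1 by rewrite sun_chi sun_min_degree.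
split.
  exists sun; do !split=> //; last exact: sun_fall_set.
  exact: elimination_chordal sun_elimination.
move=> /(_ sun sun0 sunP)[/(_ sunchi) /(_ (chi sun)) + _].
by rewrite sun_fall_set !inE eqxx.
Qed.
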